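(* Let $\Gamma$ be a discrete group and let $\omega : \Gamma \to (0,\infty)$ be a weight function, i.e. $\omega(xy) \le \omega(x)\omega(y)$ for all $x,y\in\Gamma$, such that $$\inf_{x\in\Gamma} \omega(x) > 0$$ (this happens, for example, if $\omega$ is symmetric, i.e. $\omega(x^{-1}) = \omega(x)$ for all $x\in\Gamma$). Then the weighted convolution algebra $\ell^1(\Gamma,\omega)$ is directly finite: whenever $a,b\in\ell^1(\Gamma,\omega)$ satisfy $a*b=\delta_e$, they also satisfy $b*a=\delta_e$.
   Context: For a discrete group $\Gamma$ with identity $e$ and a weight function $\omega$ on $\Gamma$, $\ell^1(\Gamma,\omega)$ is the unital Banach algebra of all functions $a : \Gamma \to \mathbb{C}$ with $\sum_{x \in \Gamma} |a(x)|\,\omega(x) < \infty$, with convolution product $(a*b)(z) = \sum_{y\in\Gamma} a(zy^{-1}) b(y)$ and unit $\delta_e$ (the indicator function of $\{e\}$). *)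

(* Defs.v *)
From mathcomp Require Import all_boot all_order all_algebra finmap complex.
From mathcomp Require Import all_classical all_reals topology normedtype esum.
From mathcomp.analysis.showcase Require summability.
Import Order.TTheory GRing.Theory Num.Theory numFieldNormedType.Exports.

Set Implicit Arguments.
Unset Strict Implicit.
Unset Printing Implicit Defensive.

Local Open Scope classical_set_scope.
Local Open Scope ring_scope.

Section weighted_convolution_algebra.
Context {R : realType} {Gamma : groupType}.

Definition is_weight (omega : Gamma -> R) : Prop :=
  (forall x, 0 < omega x) /\
  (forall x y, omega (x * y)%g <= omega x * omega y).

Definition symmetric_weight (omega : Gamma -> R) : Prop :=
  forall x, omega (x^-1)%g = omega x.

(* [Normc.normc] is the complex modulus with values in [R] rather than
   [R[i]]. *)
Definition ell1 (omega : Gamma -> R) : set (Gamma -> R[i]) :=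
  [set a | (\esum_(x in [set: Gamma])
              (Normc.normc (a x) * omega x)%:E < +oo)%E].

(* Unordered sum: the limit, in the norm topology of [R[i]], of the sums over
   finite subsets of [Gamma] directed by inclusion.  It is a total operator,
   meaningful when the family is summable. *)
Definition csum (f : Gamma -> R[i]) : R[i] :=
  @summability.sum Gamma R[i] (R[i]^o) f.

Definition conv (a b : Gamma -> R[i]) : Gamma -> R[i] :=
  fun z => csum (fun y => a (z * y^-1)%g * b y).

Definition delta1 : Gamma -> R[i] := fun x => (x == 1%g)%:R.

End weighted_convolution_algebra.

(* Main.v *)
(* Since [omega] is bounded below, [ell1 omega] is contained in the unweighted
   convolution algebra [A], which carries the involution
   [a^*(x) = conj (a x^-1)] and the tracial form [tau a = Re (a 1)], with
   [tau (a a^* )] the squared l2-norm.  If [a b = 1], then [e = 1 - b a] lies in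
   the right ideal [I = {g | a g = 0}], acts on it as a left unit, and
   [tau e = tau (a b) - tau (b a) = 0].  The following is Passman's elementary
   substitute for Kaplansky's theorem on traces of idempotents.  Let [f] in [I]
   almost realise the l2-distance from [1] to [I].  Then [f - 1] is almost
   orthogonal to [I]: this makes [(f - 1) e] small in l2, hence [f e] close to
   [e] and [tau f = tau (e f) = tau (f e)] close to [tau e = 0], and it makes
   [tau (f f^* )] close to [tau f].  So [f], then [f e], then [e] are small. *)

Require Import Defs.
From HB Require Import structures.
From mathcomp Require Import all_boot all_order all_algebra complex finmap.
From mathcomp Require Import all_classical all_reals ereal topology normedtype.
From mathcomp Require Import esum.
From mathcomp.analysis.showcase Require summability.
From mathcomp Require Import ring lra.
Import Order.TTheory GRing.Theory Num.Theory numFieldNormedType.Exports.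
Set Implicit Arguments.
Unset Strict Implicit.
Unset Printing Implicit Defensive.
Local Open Scope classical_set_scope.
Local Open Scope ring_scope.
Local Open Scope complex_scope.
Import Normc.

(** * An algebra with a faithful trace is directly finite *)

(** Evaluate the quadratic at its minimiser [t = b / n]. If [n = 0] it is affine in [t], and
    nonnegativity forces [b = 0]. *)
Lemma discriminant_le (R : realFieldType) (d b n : R) : 0 <= d -> 0 <= n ->
  (forall t : R, 0 <= d - 2 * t * b + t ^+ 2 * n) -> b ^+ 2 <= d * n.
Proof.
move=> d0 n0 quad.
have [n_eq0|n_neq0] := eqVneq n 0.
  have [->|b0] := eqVneq b 0; first by rewrite expr0n/= mulr_ge0.
  (* This [t] is chosen so that the affine function takes the value -1. *)
  have := quad ((d + 1) / (2 * b)).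
  have -> : d - 2 * ((d + 1) / (2 * b)) * b + ((d + 1) / (2 * b)) ^+ 2 * n
    = -1 by rewrite n_eq0; field.
  by rewrite oppr_ge0 ler10.
have n_gt0 : 0 < n by rewrite lt_def n_neq0.
have := quad (b / n).
have -> : d - 2 * (b / n) * b + (b / n) ^+ 2 * n = (d * n - b ^+ 2) / n.
  by field.
by rewrite pmulr_lge0 ?invr_gt0// subr_ge0.
Qed.

(** The real inner product [tau (x * star y)] carries the whole argument. [trace_bound] says that
    right multiplication by [y] is bounded for the norm of this inner product, with no completeness
    involved. *)
Record is_trace (R : realType) (A : algType R) (star : A -> A)
    (tau : A -> R) : Prop := IsTrace {
  starM : forall x y, star (x * y) = star y * star x;
  starK : involutive star;
  traceB : {morph tau : x y / x - y};
  traceZ : forall (t : R) x, tau (t *: x) = t * tau x;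
  traceC : forall x y, tau (x * y) = tau (y * x);
  trace_star : forall x, tau (star x) = tau x;
  trace_ge0 : forall x, 0 <= tau (x * star x);
  trace_eq0 : forall x, tau (x * star x) = 0 -> x = 0;
  trace_bound : forall y, exists2 C, 0 <= C &
    forall x, tau (x * y * star (x * y)) <= C * tau (x * star x)
}.

Definition trace_form (R : realType) (A : algType R) (star : A -> A)
  (tau : A -> R) (x y : A) : R := tau (x * star y).

Section directly_finite.
Context {R : realType} {A : algType R} {star : A -> A} {tau : A -> R}.
Context (trP : is_trace star tau).
Implicit Types (x y z a b e f g : A) (t d : R).

Local Notation B := (trace_form star tau).
Local Notation N x := (B x x).

Let BBl x y z : B (x - y) z = B x z - B y z.
Proof. by rewrite /trace_form mulrBl (traceB trP). Qed.

Let BC x y : B x y = B y x.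
Proof. by rewrite /trace_form -(trace_star trP) (starM trP) (starK trP). Qed.

(** The record does not list additivity of [star]; linearity in the second argument is transported
    from the first by symmetry. *)
Let BBr x y z : B x (y - z) = B x y - B x z.
Proof. by rewrite (BC x (y - z)) BBl (BC y) (BC z). Qed.

Let BNl x y : B (- x) y = - B x y.
Proof.
have t0 : tau 0 = 0 by rewrite -(subrr (0 : A)) (traceB trP) subrr.
by rewrite -sub0r BBl /trace_form mul0r t0 sub0r.
Qed.

Let BNr x y : B x (- y) = - B x y.
Proof. by rewrite (BC x (- y)) BNl (BC y). Qed.

Let BZl t x y : B (t *: x) y = t * B x y.
Proof. by rewrite /trace_form -scalerAl (traceZ trP). Qed.

Let BZr t x y : B x (t *: y) = t * B x y.
Proof. by rewrite (BC x (_ *: _)) BZl (BC y). Qed.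

(** Right multiplication by [star y] is the adjoint of right multiplication by [y]. *)
Let BMr x y z : B (x * y) z = B x (z * star y).
Proof. by rewrite /trace_form (starM trP) (starK trP) mulrA. Qed.

Let N_ge0 x : 0 <= N x. Proof. exact: (trace_ge0 trP). Qed.

Let NB x y : N (x - y) = N x - 2 * B x y + N y.
Proof. rewrite BBl !BBr (BC y x); ring. Qed.

Let cauchy_schwarz x y : B x y ^+ 2 <= N x * N y.
Proof.
apply: discriminant_le => // t.
by have := N_ge0 (x - t *: y); rewrite NB BZr !BZl BZr !mulrA -expr2.
Qed.

(** Parallelogram law with the nonnegative term [N (x + y)] dropped. *)
Let NB_le x y : N (x - y) <= 2 * N x + 2 * N y.
Proof.
have := N_ge0 (x + y); have := NB x (- y); rewrite opprK => ->.
rewrite BNr BNl BNr opprK NB; lra.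
Qed.

(* [f] almost minimises the distance from [1] to the right annihilator of [a],
   hence [f - 1] is almost orthogonal to it. *)
Let near_projection a d : 0 < d -> exists2 f, a * f = 0 &
  forall g, a * g = 0 -> B (f - 1) g ^+ 2 <= d * N g.
Proof.
move=> d0; pose S := [set r | exists2 f, a * f = 0 & r = N (f - 1)].
have S0 : S !=set0 by exists (N (0 - 1)); exists 0; rewrite ?mulr0.
have Slb : lbound S 0 by move=> _ [f _ ->].
have infS : has_inf S by split => //; exists 0.
have [_ [f af0 ->] lef] := inf_adherent d0 infS.
exists f => // g ag0; apply: discriminant_le => //; first exact: ltW.
move=> t.
(* [f - t *: g] stays in the annihilator, while [N (f - 1) < inf S + d]; comparing the two gives the
   quadratic in [t]. *)
have : inf S <= N (f - t *: g - 1).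
  apply: ge_inf => //; first by exists 0.
  by exists (f - t *: g); rewrite // mulrBr af0 -scalerAr ag0 scaler0 subr0.
have -> : f - t *: g - 1 = (f - 1) - t *: g by rewrite addrAC.
rewrite NB BZr BZl BZr; lra.
Qed.

(** The limiting argument is made quantitative: [N e] is at most [s] times a constant independent of
    [s], for every [s] in (0, 1]. *)
Lemma traced_directly_finite a b : a * b = 1 -> b * a = 1.
Proof.
move=> ab1; pose e := 1 - b * a.
have ae0 : a * e = 0 by rewrite /e mulrBr mulr1 mulrA ab1 mul1r subrr.
have te0 : tau e = 0 by rewrite (traceB trP) (traceC trP) ab1 subrr.
have [C C0 HC] := trace_bound trP e.
have [C' C'0 HC'] := trace_bound trP (star e).
suff Ne0 : N e = 0.
  by apply/eqP; rewrite eq_sym -subr_eq0; apply/eqP/(trace_eq0 trP).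
(* Chosen so that [C' * N 1 <= K ^+ 2], which avoids a square root in the bound on [tau f]. *)
pose K := C' * N 1 + 1.
have K1 : 1 <= K by rewrite lerDr mulr_ge0.
have key s : 0 < s -> s <= 1 -> N e <= s * (2 * C * (1 + 2 * K) + 2 * C').
  move=> s0 s1.
  (* The tolerance is [s ^+ 2], so that a square root still leaves an error of order [s]. *)
  have [f af0 fP] := near_projection a (exprn_gt0 2 s0).
  pose g := (f - 1) * e.
  have ag0 : a * g = 0.
    by rewrite /g mulrA (mulrBr a) af0 mulr1 sub0r mulNr ae0 oppr0.
  (* Moving [e] across the form gives [N g = B (f - 1) (g * star e)], and [g * star e] is again
     annihilated by [a]. Near orthogonality then bounds [N g ^+ 2] by a multiple of [N g], which is
     cancelled. *)
  have Ng : N g <= s ^+ 2 * C'.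
    have : N g ^+ 2 <= s ^+ 2 * (C' * N g).
      have -> : B g g ^+ 2 = B (f - 1) (g * star e) ^+ 2 by rewrite {1}/g BMr.
      apply: le_trans (fP _ _) _.
        by rewrite mulrA ag0 mul0r.
      by rewrite ler_wpM2l ?exprn_ge0 ?(ltW s0)//; exact: HC'.
    have [->|Ng0] := eqVneq (N g) 0.
      by move=> _; rewrite mulr_ge0 ?exprn_ge0 ?(ltW s0).
    by rewrite expr2 mulrA ler_pM2r// lt_def Ng0 N_ge0.
  (* Since [e * f = f], the trace property gives [tau f = tau (f * e)], which is [tau g] because
     [tau e = 0]. *)
  have tf : tau f = B g 1.
    have ef : e * f = f by rewrite /e mulrBl mul1r -mulrA af0 mulr0 subr0.
    have -> : B g 1 = tau g.
      by rewrite BC /trace_form mul1r (trace_star trP).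
    by rewrite /g mulrBl mul1r (traceB trP) te0 subr0 (traceC trP) ef.
  have Htf : `|tau f| <= s * K.
    rewrite -(@ler_pXn2r _ 2) ?nnegrE ?mulr_ge0 ?(ltW s0)//; last by lra.
    rewrite real_normK ?num_real// tf (le_trans (cauchy_schwarz _ _))//.
    apply: (@le_trans _ _ (s ^+ 2 * C' * N 1)); first by rewrite ler_wpM2r.
    rewrite exprMn -mulrA ler_wpM2l ?exprn_ge0 ?(ltW s0)//.
    rewrite /K; move: (mulr_ge0 C'0 (N_ge0 1)); nra.
  have Nf : N f <= s * (1 + 2 * K).
    have Nf : N f = B (f - 1) f + tau f.
      by rewrite BBl /trace_form mul1r (trace_star trP) subrK.
    (* Near orthogonality tested on [f] itself, followed by the inequality of arithmetic and
       geometric means for [s ^+ 2] and [N f]. *)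
    have Bf : 2 * B (f - 1) f <= s ^+ 2 + N f.
      rewrite leNgt; apply/negP => lt_sB.
      have n0 : 0 <= s ^+ 2 + N f by rewrite addr_ge0 ?sqr_ge0.
      have := ltr_pM n0 n0 lt_sB lt_sB; have := fP f af0.
      have := sqr_ge0 (s ^+ 2 - N f); lra.
    have : s ^+ 2 <= s by rewrite expr2 ler_piMl// ltW.
    have := ler_norm (tau f).
    lra.
  have -> : e = f * e - g by rewrite /g mulrBl mul1r opprB addrC subrK.
  apply: le_trans (NB_le _ _) _.
  have := HC f; rewrite -[tau _]/(N _) -[tau (f * star f)]/(N f) => Nfe.
  have : C * N f <= C * (s * (1 + 2 * K)) by rewrite ler_wpM2l.
  have : s ^+ 2 * C' <= s * C' by rewrite ler_wpM2r// expr2 ler_piMl// ltW.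
  lra.
apply/eqP; rewrite eq_le N_ge0 andbT; apply/ler_addgt0Pr => r r0; rewrite add0r.
set M := 2 * C * (1 + 2 * K) + 2 * C' in key.
have M0 : 0 <= M by rewrite /M; nra.
(* This value of [s] is at most 1 because [M] is nonnegative, and it satisfies [s * M <= r]. *)
have s0 : 0 < r / (M + r) by rewrite divr_gt0// ltr_wpDl.
have := key _ s0; rewrite ler_pdivrMr ?ltr_wpDl// mul1r lerDr => /(_ M0).
move/le_trans; apply; rewrite mulrAC ler_pdivrMr ?ltr_wpDl//.
by rewrite ler_wpM2l ?(ltW r0)// lerDl ltW.
Qed.

End directly_finite.

(** * Absolutely summable complex families *)

#[local] Existing Instance summability.totally_filter.

Lemma normc_real (R : rcfType) (x : R) : normc x%:C = `|x|.
Proof. by rewrite /= expr0n addr0 sqrtr_sqr. Qed.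

Lemma normc_ge0 (R : rcfType) (z : R[i]) : 0 <= normc z.
Proof. by case: z => x y; exact: sqrtr_ge0. Qed.

Lemma normr_Re_le (R : rcfType) (z : R[i]) : `|complex.Re z| <= normc z.
Proof.
case: z => x y /=; rewrite -sqrtr_sqr ler_wsqrtr// lerDl; exact: sqr_ge0.
Qed.

Lemma normr_Im_le (R : rcfType) (z : R[i]) : `|complex.Im z| <= normc z.
Proof.
case: z => x y /=; rewrite -sqrtr_sqr ler_wsqrtr// lerDr; exact: sqr_ge0.
Qed.

Lemma normc_conj (R : rcfType) (z : R[i]) : normc (conjc z) = normc z.
Proof. by case: z => x y /=; rewrite sqrrN. Qed.

Definition abs_summable (R : realType) (T : choiceType) (f : T -> R[i]) : Prop :=
  (\esum_(x in [set: T]) (normc (f x))%:E < +oo)%E.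

(** [fine] sends an infinite sum to 0, so the value is the norm only for an [abs_summable]
    family. *)
Definition l1norm (R : realType) (T : choiceType) (f : T -> R[i]) : R :=
  fine (\esum_(x in [set: T]) (normc (f x))%:E).

Section abs_summable_theory.
Context {R : realType} {T : choiceType}.
Implicit Types (f g : T -> R[i]) (p : T -> R) (c : R[i]).
Local Notation csum f := (@summability.sum T R[i] R[i]^o f).

Lemma l1norm_ge0 f : 0 <= l1norm f.
Proof. by rewrite fine_ge0// esum_ge0// => x _; rewrite lee_fin normc_ge0. Qed.

Lemma l1normE f : abs_summable f ->
  \esum_(x in [set: T]) (normc (f x))%:E = (l1norm f)%:E.
Proof.
move=> sf; rewrite /l1norm fineK// ge0_fin_numE// esum_ge0// => x _.
by rewrite lee_fin normc_ge0.
Qed.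

Lemma abs_summable_le f (k : T -> \bar R) :
  (forall x, ((normc (f x))%:E <= k x)%E) ->
  (\esum_(x in [set: T]) k x < +oo)%E -> abs_summable f.
Proof. by move=> fk; apply: le_lt_trans; apply: le_esum => x _. Qed.

Lemma abs_summableW f g : (forall x, normc (f x) <= normc (g x)) ->
  abs_summable g -> abs_summable f.
Proof. by move=> fg; apply: abs_summable_le => x; rewrite lee_fin. Qed.

Lemma abs_summableD f g : abs_summable f -> abs_summable g ->
  abs_summable (fun x => f x + g x).
Proof.
move=> sf sg; apply: (@abs_summable_le _
    (fun x => (normc (f x))%:E + (normc (g x))%:E)%E).
  by move=> x; rewrite -EFinD lee_fin; exact: le_normcD.
rewrite esumD => [||]; last 2 first.
- by move=> x _; rewrite lee_fin normc_ge0.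
- by move=> x _; rewrite lee_fin normc_ge0.
exact: lte_add_pinfty.
Qed.

(** One inequality holds for every nonnegative factor by looking at finite sums; applying it with
    the factor [c^-1] to the family [c * k] gives the other. *)
Lemma esumZl (c : R) (k : T -> \bar R) : 0 <= c -> (forall x, 0 <= k x)%E ->
  (\esum_(x in [set: T]) (c%:E * k x) = c%:E * \esum_(x in [set: T]) k x)%E.
Proof.
move=> c0 k0.
have le_Z (d : R) (h : T -> \bar R) : 0 <= d -> (forall x, 0 <= h x)%E ->
    (\esum_(x in [set: T]) (d%:E * h x) <= d%:E * \esum_(x in [set: T]) h x)%E.
  move=> d0 h0; apply: ge_ereal_sup => _ [X [finX _] <-].
  rewrite fsbig_finite//= -ge0_sume_distrr//.
  rewrite lee_wpmul2l ?lee_fin//; apply: ereal_sup_ubound.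
  by exists X => //; rewrite fsbig_finite.
have [->|cn0] := eqVneq c 0.
  by rewrite mul0e esum1// => x _; rewrite mul0e.
have c_gt0 : 0 < c by rewrite lt_def cn0.
apply/eqP; rewrite eq_le le_Z//=.
rewrite muleC -lee_pdivlMr//.
rewrite [X in (_ <= X)%E]muleC.
apply: le_trans (le_Z _ (fun x => c%:E * k x)%E _ _).
- by apply: le_esum => x _; rewrite muleA -EFinM mulVf// mul1e.
- by rewrite invr_ge0.
- by move=> x; rewrite mule_ge0.
Qed.

Lemma abs_summableZ c f : abs_summable f -> abs_summable (fun x => c * f x).
Proof.
move=> sf; rewrite /abs_summable.
under eq_esum do rewrite normcM EFinM.
rewrite esumZl ?normc_ge0//; last by move=> x; rewrite lee_fin normc_ge0.
by rewrite l1normE// -EFinM ltry.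
Qed.

(** A summable family is a complex combination of four nonnegative ones, the positive and negative
    parts of its real and imaginary parts. Linear identities between sums thus reduce to nonnegative
    families, where extended real sums apply. *)
Lemma abs_summable_ind (P : (T -> R[i]) -> Prop) :
  (forall p, (forall x, 0 <= p x) -> abs_summable (fun x => (p x)%:C) ->
     P (fun x => (p x)%:C)) ->
  (forall f g, abs_summable f -> abs_summable g -> P f -> P g ->
     P (fun x => f x + g x)) ->
  (forall c f, abs_summable f -> P f -> P (fun x => c * f x)) ->
  forall f, abs_summable f -> P f.
Proof.
move=> Pp PD PZ f sf.
have Preal (r : T -> R) : (forall x, `|r x| <= normc (f x)) ->
    abs_summable (fun x => (r x)%:C) /\ P (fun x => (r x)%:C).
  move=> rf.
  have part (s : T -> R) : (forall x, `|s x| <= `|r x|) ->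
      abs_summable (fun x => (Num.max (s x) 0)%:C) /\
      P (fun x => (Num.max (s x) 0)%:C).
    move=> sr.
    have sp : abs_summable (fun x => (Num.max (s x) 0)%:C).
      apply: abs_summableW sf => x; rewrite normc_real.
      rewrite (le_trans _ (rf x))// (le_trans _ (sr x))//.
      by case: (leP (s x) 0) => _; rewrite ?normr0.
    by split => //; apply: Pp => // x; rewrite le_max lexx orbT.
  have [|s1 P1] := part r; first by [].
  have [|s2 P2] := part (fun x => - r x); first by move=> x; rewrite normrN.
  have -> : (fun x => (r x)%:C) = fun x => (Num.max (r x) 0)%:C +
      - 1 * (Num.max (- r x) 0)%:C.
    apply/funext => x; rewrite mulN1r -rmorphB /=; congr (_%:C).
    case: (leP (r x) 0); case: (leP (- r x) 0); lra.
  by split; [apply: abs_summableD => //; exact: abs_summableZ|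
             apply: PD => //; [exact: abs_summableZ|exact: PZ]].
have [|s1 P1] := Preal (fun x => complex.Re (f x)).
  by move=> x; exact: normr_Re_le.
have [|s2 P2] := Preal (fun x => complex.Im (f x)).
  by move=> x; exact: normr_Im_le.
have -> : f = fun x => (complex.Re (f x))%:C + 'i * (complex.Im (f x))%:C.
  by apply/funext => x; exact: complexE.
by apply: PD => //; [exact: abs_summableZ|exact: PZ].
Qed.

Let partial_sum_real p (B : {fset T}) :
  @summability.partial_sum T R[i]^o (fun x => (p x)%:C) B =
  (\sum_(x <- B) p x)%:C.
Proof.
rewrite /summability.partial_sum.
by rewrite -(big_seq_fsetE _ _ predT (fun x => (p x)%:C)) raddf_sum.
Qed.

Let sum_le_esum p (B : {fset T}) :
  ((\sum_(x <- B) p x)%:E <= \esum_(x in [set: T]) (p x)%:E)%E.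
Proof.
apply: ereal_sup_ubound; exists [set` B] => //.
by rewrite fsbig_finite//= set_fsetK sumEFin.
Qed.

(** Monotone convergence: some finite set has a sum above [s - e], and the sum over any larger
    finite set lies between that one and the supremum [s]. *)
Let csum_cvg_nneg p : (forall x, 0 <= p x) -> abs_summable (fun x => (p x)%:C) ->
  @summability.partial_sum T R[i]^o (fun x => (p x)%:C) @ summability.totally
    --> ((l1norm (fun x => (p x)%:C))%:C : R[i]^o).
Proof.
move=> p0 sp; have esE : \esum_(x in [set: T]) (p x)%:E =
    (l1norm (fun x => (p x)%:C))%:E.
  by rewrite -l1normE//; apply: eq_esum => x _; rewrite normc_real ger0_norm.
(* In the order of [R[i]], positivity of the radius forces its imaginary part to vanish. *)
apply/cvgrPdist_lt => -[e e']; rewrite ltcE /= => /andP[/eqP-> e0].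
set s := l1norm _ in esE *.
have : ((s - e)%:E < \esum_(x in [set: T]) (p x)%:E)%E.
  by rewrite esE lte_fin ltrBlDr ltrDl.
move=> /ereal_sup_gt[_ [X [finX _] <-]].
rewrite fsbig_finite//= sumEFin lte_fin => ltX.
exists (fset_set X) => // B /= XB.
rewrite partial_sum_real -rmorphB /=.
have leB : \sum_(x <- B) p x <= s by rewrite -lee_fin -esE sum_le_esum.
have leXB : \sum_(x <- fset_set X) p x <= \sum_(x <- B) p x.
  rewrite -lee_fin -!sumEFin.
  apply: (@lee_sum_nneg_subfset _ _ (fset_set X) B predT (fun x => (p x)%:E)).
    exact/fsubsetP.
  by move=> x _ _; rewrite lee_fin.
rewrite ltcE/= eqxx expr0n/= addr0 sqrtr_sqr ger0_norm; lra.
Qed.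

Let csumP f (s : R[i]) :
  @summability.partial_sum T R[i]^o f @ summability.totally --> (s : R[i]^o) ->
  csum f = s.
Proof. by move=> fs; apply: (@cvg_lim R[i]^o) => //; exact: norm_hausdorff. Qed.

Let sum_cvgD f g (s t : R[i]) :
  @summability.partial_sum T R[i]^o f @ summability.totally --> (s : R[i]^o) ->
  @summability.partial_sum T R[i]^o g @ summability.totally --> (t : R[i]^o) ->
  @summability.partial_sum T R[i]^o (fun x => f x + g x) @ summability.totally
    --> (s + t : R[i]^o).
Proof.
move=> fs gt.
have -> : @summability.partial_sum T R[i]^o (fun x => f x + g x) =
    summability.partial_sum (f : T -> R[i]^o) +
    summability.partial_sum (g : T -> R[i]^o).
  by apply/funext => B; rewrite /= /summability.partial_sum big_split.
exact: (cvgD fs gt).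
Qed.

Let sum_cvgZ c f (s : R[i]) :
  @summability.partial_sum T R[i]^o f @ summability.totally --> (s : R[i]^o) ->
  @summability.partial_sum T R[i]^o (fun x => c * f x) @ summability.totally
    --> (c * s : R[i]^o).
Proof.
move=> fs.
have -> : @summability.partial_sum T R[i]^o (fun x => c * f x) =
    c \*: summability.partial_sum (f : T -> R[i]^o).
  by apply/funext => B; rewrite /= /summability.partial_sum scaler_sumr.
exact: cvgZl_tmp.
Qed.

(** Guarantees that the total operator [csum] returns a genuine limit on summable families. *)
Lemma csum_cvg f : abs_summable f ->
  @summability.partial_sum T R[i]^o f @ summability.totally --> (csum f : R[i]^o).
Proof.
move: f; apply: abs_summable_ind => [p p0 sp|f g sf sg cf cg|c f sf cf].
- by have cp := csum_cvg_nneg p0 sp; rewrite (csumP cp).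
- by have cfg := sum_cvgD cf cg; rewrite (csumP cfg).
- by have cfg := sum_cvgZ (c := c) cf; rewrite (csumP cfg).
Qed.

Lemma csum_nneg p : (forall x, 0 <= p x) -> abs_summable (fun x => (p x)%:C) ->
  csum (fun x => (p x)%:C) = (l1norm (fun x => (p x)%:C))%:C.
Proof. by move=> p0 sp; apply: csumP; exact: csum_cvg_nneg. Qed.

Lemma csumD f g : abs_summable f -> abs_summable g ->
  csum (fun x => f x + g x) = csum f + csum g.
Proof.
by move=> sf sg; apply: csumP; apply: sum_cvgD; exact: csum_cvg.
Qed.

Lemma csumZ c f : abs_summable f -> csum (fun x => c * f x) = c * csum f.
Proof.
by move=> sf; apply: csumP; apply: sum_cvgZ; exact: csum_cvg.
Qed.

(** A single finite partial sum within [e] of the total suffices, since its modulus is bounded by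
    the finite triangle inequality. *)
Lemma normc_csum f : abs_summable f -> normc (csum f) <= l1norm f.
Proof.
move=> sf; have /cvgrPdist_lt cf := csum_cvg sf.
apply/ler_addgt0Pr => e e0.
have e0' : 0 < e%:C by rewrite ltcR.
have [A _ /(_ A) /=] := cf _ e0'.
rewrite fsubset_refl => /(_ isT).
rewrite ltcE /= => /andP[_ h].
set s := csum f in h *; set t := summability.partial_sum f A in h *.
have -> : s = (s - t) + t by rewrite subrK.
apply: le_trans (le_normcD _ _) _.
rewrite addrC lerD//; last exact: ltW.
rewrite -lee_fin -l1normE//.
apply: le_trans (sum_le_esum _ A).
rewrite lee_fin /t /summability.partial_sum -(big_seq_fsetE _ _ predT f).
elim/big_ind2 : _ => //= [|x y z w xy zw].
  by rewrite expr0n/= addr0 sqrtr0.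
by apply: le_trans (le_normcD _ _) _; rewrite lerD.
Qed.

End abs_summable_theory.

Lemma normc_le_l1norm (R : realType) (T : choiceType) (f : T -> R[i]) (x : T) :
  abs_summable f -> normc (f x) <= l1norm f.
Proof.
move=> sf; rewrite -lee_fin -l1normE//.
have n0 y : (0 <= (normc (f y))%:E)%E by rewrite lee_fin normc_ge0.
rewrite -(@esum_set1 _ _ x (fun y => (normc (f y))%:E))// esum_mkcond.
by apply: le_esum => y _; case: ifP.
Qed.

Lemma l1normW (R : realType) (T : choiceType) (f g : T -> R[i]) :
  (forall x, normc (f x) <= normc (g x)) -> abs_summable g ->
  l1norm f <= l1norm g.
Proof.
move=> fg sg; rewrite -lee_fin -!l1normE//; last exact: abs_summableW sg.
by apply: le_esum => x _; rewrite lee_fin.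
Qed.

Lemma l1normD (R : realType) (T : choiceType) (f g : T -> R[i]) :
  abs_summable f -> abs_summable g ->
  l1norm (fun x => f x + g x) <= l1norm f + l1norm g.
Proof.
move=> sf sg; rewrite -lee_fin EFinD -!l1normE//; last exact: abs_summableD.
rewrite -esumD => [||]; last 2 first.
- by move=> x _; rewrite lee_fin normc_ge0.
- by move=> x _; rewrite lee_fin normc_ge0.
by apply: le_esum => x _; rewrite -EFinD lee_fin; exact: le_normcD.
Qed.

Lemma l1normZ (R : realType) (T : choiceType) (c : R[i]) (f : T -> R[i]) :
  abs_summable f -> l1norm (fun x => c * f x) = normc c * l1norm f.
Proof.
move=> sf; apply: EFin_inj; rewrite EFinM -!l1normE//; last exact: abs_summableZ.
under eq_esum do rewrite normcM EFinM.
by rewrite esumZl ?normc_ge0// => x; rewrite lee_fin normc_ge0.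
Qed.

(** * Reindexing, conjugation and Fubini for unordered complex sums *)

Section csum_families.
Context {R : realType}.
Local Notation csum f := (@summability.sum _ R[i] R[i]^o f).

Lemma eq_csum (T : choiceType) (f g : T -> R[i]) : f =1 g -> csum f = csum g.
Proof. by move=> /funext ->. Qed.

Lemma esum_bij (T T' : choiceType) (phi : T -> T') (k : T' -> \bar R) :
  bijective phi -> \esum_(x in [set: T]) k (phi x) = \esum_(y in [set: T']) k y.
Proof.
move=> bphi; rewrite [RHS](reindex_esum [set: T] _ phi)//.
by rewrite setTT_bijective.
Qed.

Lemma abs_summable_bij (T T' : choiceType) (phi : T -> T') (f : T' -> R[i]) :
  bijective phi -> abs_summable f -> abs_summable (fun x => f (phi x)).
Proof.
by move=> bphi; rewrite /abs_summable (esum_bij (fun y => (normc (f y))%:E) bphi).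
Qed.

Lemma l1norm_bij (T T' : choiceType) (phi : T -> T') (f : T' -> R[i]) :
  bijective phi -> l1norm (fun x => f (phi x)) = l1norm f.
Proof.
by move=> bphi; rewrite /l1norm (esum_bij (fun y => (normc (f y))%:E) bphi).
Qed.

Lemma csum_bij (T T' : choiceType) (phi : T -> T') (f : T' -> R[i]) :
  bijective phi -> abs_summable f -> csum (fun x => f (phi x)) = csum f.
Proof.
move=> bphi; move: f; apply: abs_summable_ind => [p p0 sp|f g sf sg|c f sf].
- have sp' := abs_summable_bij bphi sp.
  rewrite (csum_nneg p0 sp) (csum_nneg (p := fun x => p (phi x)))//.
  by rewrite (l1norm_bij (fun y => (p y)%:C)).
- by rewrite !csumD// => [-> ->//||]; exact: abs_summable_bij.
- by rewrite !csumZ// => [->//|]; exact: abs_summable_bij.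
Qed.

Lemma csum_conj (T : choiceType) (f : T -> R[i]) : abs_summable f ->
  csum (fun x => conjc (f x)) = conjc (csum f).
Proof.
have sconj (g : T -> R[i]) : abs_summable g -> abs_summable (fun x => conjc (g x)).
  by apply: abs_summableW => x; rewrite normc_conj.
move: f; apply: abs_summable_ind => [p p0 sp|f g sf sg cf cg|c f sf cf].
- rewrite (_ : (fun x => conjc _) = fun x => (p x)%:C).
    by rewrite csum_nneg//= oppr0.
  by apply/funext => x /=; rewrite oppr0.
- rewrite csumD// rmorphD/= -cf -cg -csumD; [|exact: sconj..].
  by apply: eq_csum => x; rewrite rmorphD.
- rewrite csumZ// rmorphM/= -cf -csumZ; last exact: sconj.
  by apply: eq_csum => x; rewrite rmorphM.
Qed.

(** Serves the unit laws of convolution, whose terms vanish off one point: the family is a multiple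
    of an indicator of sum 1. *)
Lemma abs_summable_point (T : choiceType) (x0 : T) (f : T -> R[i]) :
  (forall x, x != x0 -> f x = 0) -> abs_summable f /\ csum f = f x0.
Proof.
move=> f0; pose d x : R := (x == x0)%:R.
have es : \esum_(x in [set: T]) (normc (d x)%:C)%:E = 1%E.
  transitivity (\esum_(x in [set x0]) (normc (d x)%:C)%:E).
    rewrite [RHS]esum_mkcond; apply: eq_esum => x _.
    rewrite normc_real /d; case: ifPn; rewrite ?inE; first by [].
    rewrite notin_setE /= => /eqP/negPf ->; by rewrite normr0.
  by rewrite esum_set1 /d ?eqxx normc_real ?normr1 ?lee_fin.
have sd : abs_summable (fun x => (d x)%:C) by rewrite /abs_summable es ltry.
have -> : f = fun x => f x0 * (d x)%:C.
  apply/funext => x; rewrite /d; case: eqVneq => [->|xn]; first by rewrite mulr1.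
  by rewrite f0// mulr0.
split; first exact: abs_summableZ.
have d0 x : 0 <= d x by rewrite ler0n.
by rewrite csumZ// csum_nneg// /l1norm es /d eqxx.
Qed.

Lemma esum_pair (T1 T2 : choiceType) (k : T1 * T2 -> \bar R) :
  (forall u, 0 <= k u)%E ->
  \esum_(u in [set: T1 * T2]) k u =
  \esum_(x in [set: T1]) \esum_(y in [set: T2]) k (x, y).
Proof.
move=> k0; rewrite esum_esum//; apply: congr2 => //.
  by apply/seteqP; split.
by apply/funext => -[].
Qed.

Section pairs.
Context {T1 T2 : choiceType}.
Implicit Types (F : T1 * T2 -> R[i]).

Lemma abs_summable_pairE F : abs_summable F =
  (\esum_(x in [set: T1]) \esum_(y in [set: T2]) (normc (F (x, y)))%:E < +oo)%E.
Proof.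
by rewrite /abs_summable esum_pair// => u; rewrite lee_fin normc_ge0.
Qed.

Lemma abs_summable_row F : abs_summable F ->
  forall x, abs_summable (fun y => F (x, y)).
Proof.
rewrite abs_summable_pairE => sF x; apply: le_lt_trans sF.
set k := fun x => (\esum_(y in [set: T2]) (normc (F (x, y)))%:E)%E.
have k0 z : (0 <= k z)%E by apply: esum_ge0 => y _; rewrite lee_fin normc_ge0.
rewrite -[X in (X <= _)%E]/(k x) -(@esum_set1 _ _ x k)// esum_mkcond.
by apply: le_esum => z _; case: ifP => _ //; exact: k0.
Qed.

Lemma abs_summable_csum F : abs_summable F ->
  abs_summable (fun x => csum (fun y => F (x, y))).
Proof.
move=> sF; apply: abs_summable_le (_ : _ < +oo)%E.
2: by move: (sF); rewrite abs_summable_pairE; apply.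
move=> x /=; rewrite l1normE; last exact: abs_summable_row.
by rewrite lee_fin normc_csum//; exact: abs_summable_row.
Qed.

(** Fubini: on nonnegative families it is [esum_pair], and both sides are linear in [F]. *)
Lemma csum_pair F : abs_summable F ->
  csum F = csum (fun x => csum (fun y => F (x, y))).
Proof.
move: F; apply: abs_summable_ind => [p p0 sp|f g sf sg cf cg|c f sf cf].
- have sr := abs_summable_row sp.
  have rowE x : csum (fun y => (p (x, y))%:C) = (l1norm (fun y => (p (x, y))%:C))%:C.
    by rewrite csum_nneg// => y.
  have -> : (fun x => csum (fun y => (p (x, y))%:C)) =
      fun x => (l1norm (fun y => (p (x, y))%:C))%:C by apply/funext.
  rewrite !csum_nneg//; last 2 first.
  + by move=> x; exact: l1norm_ge0.
  + have := abs_summable_csum sp; congr abs_summable; exact/funext.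
  congr (_%:C); apply: EFin_inj; rewrite -!l1normE//; last first.
    have := abs_summable_csum sp; congr abs_summable; exact/funext.
  rewrite esum_pair; last by move=> u; rewrite lee_fin normc_ge0.
  apply: eq_esum => x _; rewrite l1normE// normc_real ger0_norm//.
  exact: l1norm_ge0.
- rewrite csumD// cf cg -csumD; [|exact: abs_summable_csum..].
  apply: eq_csum => x; rewrite csumD//; exact: abs_summable_row.
- rewrite csumZ// cf -csumZ; last exact: abs_summable_csum.
  apply: eq_csum => x; rewrite csumZ//; exact: abs_summable_row.
Qed.

End pairs.

Lemma csum_exchange (T1 T2 : choiceType) (F : T1 -> T2 -> R[i]) :
  abs_summable (fun u : T1 * T2 => F u.1 u.2) ->
  csum (fun x => csum (F x)) = csum (fun y => csum (fun x => F x y)).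
Proof.
move=> sF; pose swap (u : T2 * T1) := (u.2, u.1).
have bswap : bijective swap by exists (fun u => (u.2, u.1)) => -[].
have := csum_bij bswap sF; rewrite (csum_pair sF) => <-.
by rewrite (csum_pair (abs_summable_bij bswap sF)).
Qed.

End csum_families.

(** * Convolution *)

Section convolution.
Context {R : realType} {Gamma : groupType}.
Implicit Types (a b c : Gamma -> R[i]) (x y z : Gamma).
Local Notation sum f := (@summability.sum _ R[i] R[i]^o f).

Let bij_mulr z : bijective (fun y => y * z)%g.
Proof. by exists (fun y => y * z^-1)%g => y; rewrite ?mulgK ?mulgVK. Qed.

Let bij_inv : bijective (fun y : Gamma => y^-1)%g.
Proof. by exists (fun y => y^-1)%g => y; rewrite invgK. Qed.

(** For fixed [y] the sum over [z] of the moduli of [a (z * y^-1)] is [l1norm a] by translation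
    invariance, so the double sum is [l1norm a * l1norm b]. *)
Lemma abs_summable_translates a b : abs_summable a -> abs_summable b ->
  abs_summable (fun u : Gamma * Gamma => a (u.2 * u.1^-1)%g * b u.1).
Proof.
move=> sa sb; rewrite abs_summable_pairE/=.
rewrite (@eq_esum _ _ _ _ (fun y => (l1norm a)%:E * (normc (b y))%:E)%E).
  rewrite esumZl ?l1norm_ge0// => [|y]; last by rewrite lee_fin normc_ge0.
  by rewrite l1normE// -EFinM ltry.
move=> y _; rewrite -(l1norm_bij a (bij_mulr y^-1)%g) muleC.
rewrite -l1normE; last exact: (abs_summable_bij (bij_mulr y^-1)%g).
rewrite -esumZl ?normc_ge0// => [|z]; last by rewrite lee_fin normc_ge0.
by apply: eq_esum => z _; rewrite normcM EFinM muleC.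
Qed.

Lemma abs_summable_conv_term a b z : abs_summable a -> abs_summable b ->
  abs_summable (fun y => a (z * y^-1)%g * b y).
Proof.
move=> sa sb; apply: abs_summableW (abs_summableZ (l1norm a)%:C sb) => y.
rewrite !normcM normc_real ger0_norm ?l1norm_ge0//.
by rewrite ler_wpM2r ?normc_ge0// normc_le_l1norm.
Qed.

Let bij_swap : bijective (fun u : Gamma * Gamma => (u.2, u.1)).
Proof. by exists (fun u => (u.2, u.1)) => -[]. Qed.

Lemma abs_summable_conv a b : abs_summable a -> abs_summable b ->
  abs_summable (conv a b).
Proof.
move=> sa sb.
exact: (abs_summable_csum
  (abs_summable_bij bij_swap (abs_summable_translates sa sb))).
Qed.

Lemma convA a b c : abs_summable a -> abs_summable b -> abs_summable c ->
  conv a (conv b c) = conv (conv a b) c.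
Proof.
move=> sa sb sc; apply/funext => z.
pose F w y := a (z * w^-1)%g * (b (w * y^-1)%g * c y).
(* The factor coming from [a] is bounded by [l1norm a]; the rest is summable over pairs. *)
have sF : abs_summable (fun u => F u.1 u.2).
  have := abs_summable_bij bij_swap (abs_summable_translates sb sc).
  move=> /(abs_summableZ (l1norm a)%:C); apply: abs_summableW => -[w y] /=.
  rewrite normcM [leRHS]normcM normc_real ger0_norm ?l1norm_ge0//.
  by rewrite ler_wpM2r ?normc_ge0// normc_le_l1norm.
transitivity (sum (fun w => sum (F w))).
  apply: eq_csum => w; rewrite csumZ//.
  exact: abs_summable_conv_term.
rewrite csum_exchange//; apply: eq_csum => y.
have sFy : abs_summable (F^~ y).
  exact: (abs_summable_row (abs_summable_bij bij_swap sF) y).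
(* Substituting [w = x * y] turns the inner sum into [conv a b (z * y^-1)] times [c y]. *)
rewrite -(csum_bij (bij_mulr y) sFy) mulrC -csumZ; last first.
  exact: abs_summable_conv_term.
apply: eq_csum => x.
by rewrite /F mulgK invgM mulgA mulrA mulrC.
Qed.

Lemma convDl a b c : abs_summable a -> abs_summable b -> abs_summable c ->
  conv (fun x => a x + b x) c = fun x => conv a c x + conv b c x.
Proof.
move=> sa sb sc; apply/funext => z.
rewrite /conv /csum -csumD; [|exact: abs_summable_conv_term..].
by apply: eq_csum => y; rewrite mulrDl.
Qed.

Lemma convDr a b c : abs_summable a -> abs_summable b -> abs_summable c ->
  conv a (fun x => b x + c x) = fun x => conv a b x + conv a c x.
Proof.
move=> sa sb sc; apply/funext => z.
rewrite /conv /csum -csumD; [|exact: abs_summable_conv_term..].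
by apply: eq_csum => y; rewrite mulrDr.
Qed.

Lemma convZl t a b : abs_summable a -> abs_summable b ->
  conv (fun x => t * a x) b = fun x => t * conv a b x.
Proof.
move=> sa sb; apply/funext => z.
rewrite /conv /csum -csumZ; last exact: abs_summable_conv_term.
by apply: eq_csum => y; rewrite mulrA.
Qed.

Lemma convZr t a b : abs_summable a -> abs_summable b ->
  conv a (fun x => t * b x) = fun x => t * conv a b x.
Proof.
move=> sa sb; apply/funext => z.
rewrite /conv /csum -csumZ; last exact: abs_summable_conv_term.
by apply: eq_csum => y; rewrite mulrCA.
Qed.

Lemma abs_summable_delta1 : abs_summable (delta1 : Gamma -> R[i]).
Proof.
have [|//] := @abs_summable_point R Gamma 1%g delta1.
by move=> x /negPf x1; rewrite /delta1 x1.
Qed.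

Lemma conv1l a : conv delta1 a = a.
Proof.
apply/funext => z.
have [|_] := @abs_summable_point R Gamma z
    (fun y => delta1 (z * y^-1)%g * a y).
  move=> y yz; rewrite /delta1; case: eqP => [zy|]; last by rewrite mul0r.
  by move: yz; rewrite -(mulgVK y z) zy mul1g eqxx.
by rewrite /conv /csum => ->; rewrite /delta1 mulgV eqxx mul1r.
Qed.

Lemma conv1r a : conv a delta1 = a.
Proof.
apply/funext => z.
have [|_] := @abs_summable_point R Gamma 1%g
    (fun y => a (z * y^-1)%g * delta1 y).
  by move=> y /negPf y1; rewrite /delta1 y1 mulr0.
by rewrite /conv /csum => ->; rewrite /delta1 eqxx mulr1 invg1 mulg1.
Qed.

(** Inverting the summation variable exchanges the two factors; this is the trace property. *)
Lemma conv_at1C a b : abs_summable a -> abs_summable b ->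
  conv a b 1%g = conv b a 1%g.
Proof.
move=> sa sb; rewrite /conv /csum.
rewrite -[LHS](csum_bij bij_inv); last exact: abs_summable_conv_term.
apply: eq_csum => y.
by rewrite !mul1g invgK mulrC.
Qed.

(** * The involution and the l2-norm *)

Definition involute a : Gamma -> R[i] := fun x => conjc (a x^-1)%g.

Lemma abs_summable_involute a : abs_summable a -> abs_summable (involute a).
Proof.
move=> sa; apply: (abs_summableW (g := fun x => a x^-1%g)).
  by move=> x; rewrite normc_conj.
exact: (abs_summable_bij bij_inv).
Qed.

Lemma involute_conv a b : abs_summable a -> abs_summable b ->
  involute (conv a b) = conv (involute b) (involute a).
Proof.
move=> sa sb; apply/funext => z; rewrite {1}/involute /conv /csum.
rewrite -csum_conj; last exact: abs_summable_conv_term.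
rewrite -[RHS](csum_bij (bij_mulr z)); last first.
  by apply: abs_summable_conv_term; exact: abs_summable_involute.
apply: eq_csum => y.
by rewrite /involute rmorphM mulrC !invgM !invgK mulgK.
Qed.

Definition sqnorm a : R := l1norm (fun x => (normc (a x) ^+ 2)%:C).

(** Inclusion of l1 in l2: one of the two factors is bounded by [l1norm a]. *)
Lemma abs_summable_sqnorm a : abs_summable a ->
  abs_summable (fun x => (normc (a x) ^+ 2)%:C).
Proof.
move=> sa; apply: abs_summableW (abs_summableZ (l1norm a)%:C sa) => x.
rewrite normcM !normc_real normrX !ger0_norm ?normc_ge0 ?l1norm_ge0//.
by rewrite expr2 ler_wpM2r ?normc_ge0// normc_le_l1norm.
Qed.

Lemma conv_involute_at1 a : abs_summable a ->
  conv a (involute a) 1%g = (sqnorm a)%:C.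
Proof.
move=> sa; have sq := abs_summable_sqnorm sa.
rewrite /sqnorm -csum_nneg//; last by move=> x; rewrite sqr_ge0.
rewrite -(csum_bij bij_inv sq); apply: eq_csum => x.
rewrite /involute mul1g.
case: (a _) => u v /=; rewrite sqr_sqrtr ?addr_ge0 ?sqr_ge0//.
by simpc; congr (_ +i* _); ring.
Qed.

Lemma sqnorm_eq0 a : abs_summable a -> sqnorm a = 0 -> forall x, a x = 0.
Proof.
move=> sa a0 x; have := normc_le_l1norm x (abs_summable_sqnorm sa).
rewrite -/(sqnorm a) a0 normc_real ger0_norm ?sqr_ge0// => ax0.
by apply: eq0_normc; apply/eqP; rewrite -sqrf_eq0 eq_le ax0 sqr_ge0.
Qed.

(** Each term is a product [p * q] of moduli of [a] at two points, at most [p ^+ 2 + q ^+ 2], and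
    both families of squares sum to [sqnorm a] by translation. The crude factor 2 replaces the
    Cauchy-Schwarz inequality. *)
Lemma normc_involute_conv a z : abs_summable a ->
  normc (conv (involute a) a z) <= 2 * sqnorm a.
Proof.
move=> sa; have sq := abs_summable_sqnorm sa.
pose k := (fun x => x * z^-1)%g.
have bk : bijective k by exact: bij_mulr.
have sqk := abs_summable_bij bk sq.
apply: le_trans (normc_csum _) _.
  by apply: abs_summable_conv_term => //; exact: abs_summable_involute.
have -> : 2 * sqnorm a = l1norm (fun x => (normc (a (k x)) ^+ 2)%:C) + sqnorm a.
  by rewrite (l1norm_bij (fun x => (normc (a x) ^+ 2)%:C) bk) /sqnorm; ring.
apply: le_trans (l1normD sqk sq).
apply: l1normW; last exact: abs_summableD.
move=> x; rewrite -rmorphD normcM normc_conj normc_real invgM invgK.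
rewrite ger0_norm ?addr_ge0 ?sqr_ge0//.
rewrite -/(k x); move: (normc _) (normc _) (normc_ge0 (a (k x))) (normc_ge0 (a x)).
move=> p q p0 q0; have := sqr_ge0 (p - q); nra.
Qed.

Lemma normc_conv_at1 a b (C : R) : abs_summable b ->
  (forall x, normc (a x) <= C) -> abs_summable a ->
  normc (conv a b 1%g) <= C * l1norm b.
Proof.
move=> sb aC sa.
have C0 : 0 <= C by apply: le_trans (aC 1%g); exact: normc_ge0.
apply: le_trans (normc_csum _) _; first exact: abs_summable_conv_term.
have -> : C * l1norm b = l1norm (fun x => C%:C * b x).
  by rewrite l1normZ// normc_real ger0_norm.
apply: l1normW; last exact: abs_summableZ.
move=> x; rewrite [leLHS]normcM [leRHS]normcM normc_real ger0_norm//.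
by rewrite ler_wpM2r ?normc_ge0.
Qed.

End convolution.

(** * The algebra of summable functions and its trace *)

Section ell1_algebra.
Context (R : realType) (Gamma : groupType).
Local Notation fT := (Gamma -> R[i]).

(** A boolean predicate, so that [ell1_alg] inherits its additive structure as a subtype of the
    function space. *)
Definition summable_pred : {pred fT} := fun a => `[< abs_summable a >].

Record ell1_alg := Ell1Alg {
  ell1_fun : fT;
  ell1_funP : ell1_fun \in summable_pred
}.

HB.instance Definition _ := [isSub for ell1_fun].
HB.instance Definition _ := [Choice of ell1_alg by <:].

Lemma summable_zmod_closed : GRing.zmod_closed summable_pred.
Proof.
split=> [|a b /asboolP sa /asboolP sb]; apply/asboolP.
  rewrite -[0]/(fun=> 0); apply: abs_summableW abs_summable_delta1 => x.
  by rewrite normc0 normc_ge0.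
apply: (abs_summableD sa); apply: abs_summableW sb => x.
by rewrite -[(- b) x]/(- b x) normcN.
Qed.

HB.instance Definition _ :=
  GRing.isZmodClosed.Build fT summable_pred summable_zmod_closed.
HB.instance Definition _ := [SubChoice_isSubZmodule of ell1_alg by <:].

Implicit Types (a b c : ell1_alg).

Lemma ell1_summable a : abs_summable (ell1_fun a).
Proof. exact/asboolP/ell1_funP. Qed.
Local Notation sm := ell1_summable.

Definition mk_ell1 (f : fT) (sf : abs_summable f) : ell1_alg :=
  @Ell1Alg f (introT (asboolP _) sf).

(** Only real scalars, to match the real-valued trace of [is_trace]. *)
Definition ell1_scale (t : R) a : ell1_alg :=
  mk_ell1 (abs_summableZ t%:C (sm a)).
Definition ell1_mul a b : ell1_alg := mk_ell1 (abs_summable_conv (sm a) (sm b)).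
Definition ell1_one : ell1_alg := mk_ell1 (@abs_summable_delta1 R Gamma).

Fact ell1_scaleA (s t : R) a :
  ell1_scale s (ell1_scale t a) = ell1_scale (s * t) a.
Proof. by apply: val_inj; apply/funext => x /=; rewrite rmorphM mulrA. Qed.

Fact ell1_scale1 : left_id 1 ell1_scale.
Proof. by move=> a; apply: val_inj; apply/funext => x /=; rewrite mul1r. Qed.

Fact ell1_scaleDr : right_distributive ell1_scale +%R.
Proof. by move=> t a b; apply: val_inj; apply/funext => x /=; rewrite mulrDr. Qed.

Fact ell1_scaleDl a : {morph ell1_scale^~ a : s t / s + t}.
Proof.
by move=> s t; apply: val_inj; apply/funext => x /=; rewrite rmorphD mulrDl.
Qed.

HB.instance Definition _ := GRing.Zmodule_isLmodule.Build R ell1_alg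
  ell1_scaleA ell1_scale1 ell1_scaleDr ell1_scaleDl.

Fact ell1_mulA : associative ell1_mul.
Proof. by move=> a b c; apply: val_inj; apply: convA; exact: sm. Qed.

Fact ell1_mul1l : left_id ell1_one ell1_mul.
Proof. by move=> a; apply: val_inj; exact: conv1l. Qed.

Fact ell1_mul1r : right_id ell1_one ell1_mul.
Proof. by move=> a; apply: val_inj; exact: conv1r. Qed.

Fact ell1_mulDl : left_distributive ell1_mul +%R.
Proof. by move=> a b c; apply: val_inj; apply: convDl; exact: sm. Qed.

Fact ell1_mulDr : right_distributive ell1_mul +%R.
Proof. by move=> a b c; apply: val_inj; apply: convDr; exact: sm. Qed.

Fact ell1_one_neq0 : ell1_one != 0.
Proof.
apply/eqP => /(congr1 (fun a => ell1_fun a 1%g)) /eqP.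
by rewrite /= /delta1 eqxx oner_eq0.
Qed.

HB.instance Definition _ := GRing.Zmodule_isNzRing.Build ell1_alg
  ell1_mulA ell1_mul1l ell1_mul1r ell1_mulDl ell1_mulDr ell1_one_neq0.

Fact ell1_scaleAl (t : R) a b : t *: (a * b) = t *: a * b.
Proof. by apply: val_inj; symmetry; apply: convZl; exact: sm. Qed.

HB.instance Definition _ :=
  GRing.Lmodule_isLalgebra.Build R ell1_alg ell1_scaleAl.

Fact ell1_scaleAr (t : R) a b : t *: (a * b) = a * (t *: b).
Proof. by apply: val_inj; symmetry; apply: convZr; exact: sm. Qed.

HB.instance Definition _ :=
  GRing.Lalgebra_isAlgebra.Build R ell1_alg ell1_scaleAr.

Definition ell1_star a : ell1_alg := mk_ell1 (abs_summable_involute (sm a)).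
Definition ell1_trace a : R := complex.Re (ell1_fun a 1%g).

Lemma ell1_trace_star a : ell1_trace (a * ell1_star a) = sqnorm (ell1_fun a).
Proof. by rewrite /ell1_trace /= conv_involute_at1//; exact: sm. Qed.

Lemma ell1_is_trace : is_trace ell1_star ell1_trace.
Proof.
have tC a b : ell1_trace (a * b) = ell1_trace (b * a).
  by rewrite /ell1_trace /= conv_at1C//; exact: sm.
have sM a b : ell1_star (a * b) = ell1_star b * ell1_star a.
  by apply: val_inj; apply: involute_conv; exact: sm.
split.
- exact: sM.
- move=> a; apply: val_inj; apply/funext => x /=.
  by rewrite /involute invgK conjcK.
- by move=> a b; exact: raddfB.
- move=> t a; rewrite /ell1_trace /=.
  by case: (ell1_fun a _) => u v /=; rewrite mul0r subr0.
- exact: tC.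
- move=> a; rewrite /ell1_trace /= /involute invg1.
  by case: (ell1_fun a _).
- by move=> a; rewrite ell1_trace_star l1norm_ge0.
- move=> a; rewrite ell1_trace_star => a0; apply: val_inj; apply/funext => x.
  exact: (sqnorm_eq0 (sm a) a0).
(* Cycling rewrites the left side as the trace of [ell1_star a * a * h]. The sup norm of
   [ell1_star a * a] is at most [2 * sqnorm a], and it is paired with the l1-norm of [h]. *)
- move=> b; pose h := b * ell1_star b.
  exists (2 * l1norm (ell1_fun h)); first by rewrite mulr_ge0 ?l1norm_ge0.
  move=> a; have -> : ell1_trace (a * b * ell1_star (a * b)) =
      ell1_trace (ell1_star a * a * h).
    by rewrite /h sM !mulrA (tC _ (ell1_star a)) !mulrA.
  apply: le_trans (ler_norm _) _; apply: le_trans (normr_Re_le _) _.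
  rewrite ell1_trace_star mulrAC.
  apply: normc_conv_at1; [exact: sm| |exact: sm].
  by move=> x; apply: normc_involute_conv; exact: sm.
Qed.

End ell1_algebra.

(** * From weighted to unweighted summability *)

Lemma abs_summable_ell1 (R : realType) (Gamma : groupType) (omega : Gamma -> R)
    (a : Gamma -> R[i]) :
  0 < inf (range omega) -> (forall x, 0 < omega x) -> ell1 omega a ->
  abs_summable a.
Proof.
move=> i0 omega0 sa; set i := inf _ in i0.
apply: (@abs_summable_le _ _ _
    (fun x => i^-1%:E * (normc (a x) * omega x)%:E)%E).
  move=> x; rewrite -EFinM lee_fin mulrCA ler_peMr ?normc_ge0//.
  rewrite ler_pdivlMl// mulr1; apply: ge_inf; last by exists x.
  by exists 0 => _ [y _ <-]; exact: ltW.
have p0 x : (0 <= (normc (a x) * omega x)%:E)%E.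
  by rewrite lee_fin mulr_ge0 ?normc_ge0// ltW.
by rewrite esumZl ?invr_ge0 ?(ltW i0)// lte_mul_pinfty ?lee_fin ?invr_ge0 ?(ltW i0).
Qed.

(** Submultiplicativity at the identity gives [1 <= omega 1], and [omega 1] is at most
    [omega x * omega x^-1], the square of [omega x]. *)
Lemma symmetric_weight_ge1 (R : realType) (Gamma : groupType)
    (omega : Gamma -> R) :
  is_weight omega -> symmetric_weight omega -> forall x, 1 <= omega x.
Proof.
move=> [w0 wM] wV x.
have w1 : 1 <= omega 1%g.
  by have := wM 1%g 1%g; rewrite mulg1 ler_pMr.
have := wM x x^-1%g; rewrite mulgV wV => /(le_trans w1).
by rewrite -expr2 expr_ge1// ltW.
Qed.

Theorem lemma6 (R : realType) (Gamma : groupType) (omega : Gamma -> R)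
    (weight_omega : is_weight omega) :
  (symmetric_weight omega -> 0 < inf (range omega)) /\
  (0 < inf (range omega) ->
   forall a b : Gamma -> R[i], ell1 omega a -> ell1 omega b ->
     conv a b = delta1 -> conv b a = delta1).
Proof.
split=> [wV|i0 a b la lb ab1].
  apply: lt_le_trans (ltr01) _; apply: lb_le_inf.
    by exists (omega 1%g); exists 1%g.
  by move=> _ [x _ <-]; exact: symmetric_weight_ge1.
have [w0 _] := weight_omega.
have sa := abs_summable_ell1 i0 w0 la; have sb := abs_summable_ell1 i0 w0 lb.
(* [conv] does not involve the weight, so the hypothesis is already an identity in the unweighted
   algebra. *)
have AB1 : mk_ell1 sa * mk_ell1 sb = 1 by apply: val_inj.
have := traced_directly_finite (ell1_is_trace R Gamma) AB1.
by move=> /(congr1 (@ell1_fun R Gamma)).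
Qed.
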